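(* Let $k \geq 3$ be an integer. Every $k$-tree of toughness greater than $\frac{k}{3}$ is Hamilton-connected. Furthermore, every $1$-tough $2$-tree (except for $K_2$) is Hamiltonian.
   Context: All graphs are finite and simple. For a positive integer $k$, a $k$-tree is either the complete graph $K_k$ or a graph containing a vertex whose neighbourhood induces $K_k$ and whose removal gives a $k$-tree. The toughness of a graph $G$ is the minimum, taken over all separating sets $X$ of vertices of $G$ (sets such that $G-X$ is disconnected), of the ratio of $|X|$ to the number of components of $G-X$; the toughness of a complete graph is defined as infinite. A graph is $t$-tough if its toughness is at least $t$. A graph is Hamilton-connected if for every pair of its (distinct) vertices there is a Hamilton path between them; it is Hamiltonian if it has a Hamilton cycle. *)

(* Defs.v *)
From mathcomp Require Import all_boot all_order all_algebra.
From mathcomp Require Import constructive_ereal.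

Set Implicit Arguments.
Unset Strict Implicit.
Unset Printing Implicit Defensive.

Import Order.TTheory GRing.Theory Num.Theory.

Record sgraph := SGraph {
  vertex :> finType;
  adj : rel vertex;
  adj_sym : symmetric adj;
  adj_irrefl : irreflexive adj
}.

Section Graphs.
Variable G : sgraph.
Implicit Types (x y v : G) (A B X : {set G}).

Definition neighbours v : {set G} := [set u | adj v u].

Definition induces_complete (k : nat) B : Prop :=
  #|B| = k /\ {in B &, forall x y, x != y -> adj x y}.

(* [ktree_on k A]: the subgraph induced by A is a k-tree. In that subgraph the
   neighbourhood of v is [neighbours v :&: A], and removing v leaves the
   subgraph induced by [A :\ v]. *)
Inductive ktree_on (k : nat) : {set G} -> Prop :=
| ktree_complete A : induces_complete k A -> ktree_on k A
| ktree_extend A v :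
    v \in A -> induces_complete k (neighbours v :&: A) ->
    ktree_on k (A :\ v) -> ktree_on k A.

Definition ktree (k : nat) : Prop := ktree_on k [set: G].

Definition is_complete (k : nat) : Prop := induces_complete k [set: G].

Definition adj_minus X : rel G :=
  [rel x y | [&& x \notin X, y \notin X & adj x y]].

(* Vertices of X are isolated for [adj_minus X], hence the restriction of the
   component count to the complement of X. *)
Definition components_minus X : nat := n_comp (adj_minus X) (~: X).

Definition separating X : bool := 1 < components_minus X.

(* The value is +oo exactly when there is no separating set, that is, when G is
   complete. *)
Definition toughness : \bar rat :=
  \big[Order.min/+oo%E]_(X : {set G} | separating X)
     ((#|X|%:R / (components_minus X)%:R)%R%:E).

Definition tough (t : rat) : Prop := (t%:E <= toughness)%E.

Definition hamilton_path x y (p : seq G) : Prop :=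
  [/\ path (@adj G) x p, last x p = y, uniq (x :: p)
    & forall z, z \in x :: p].

Definition hamilton_connected : Prop :=
  forall x y, x != y -> exists p, hamilton_path x y p.

(* [ucycle] also accepts lists of length at most 2 (an edge traversed back and
   forth, for instance), which are not cycles of a simple graph. *)
Definition hamilton_cycle (c : seq G) : Prop :=
  [/\ 2 < size c, ucycle (@adj G) c & forall z, z \in c].

Definition hamiltonian : Prop := exists c, hamilton_cycle c.

End Graphs.

(* Main.v *)
Require Import Defs.
From mathcomp Require Import all_boot all_order all_algebra.
From mathcomp Require Import constructive_ereal zify.

Set Implicit Arguments.
Unset Strict Implicit.
Unset Printing Implicit Defensive.

Import Order.TTheory GRing.Theory Num.Theory.

(** Every (k+1)-clique of a k-tree cuts off at most three pieces, and every
    k-clique at most two, as soon as the toughness exceeds k/3 and k is at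
    least 3, or k = 2 and the toughness is at least 1. This local bound, called
    [frugal] below, is all that is used of the toughness; it is inherited when
    a simplicial vertex is deleted, hence it supports an induction on the
    number of vertices.

    The induction peels the k-tree from its periphery. A twig is a vertex [u]
    whose neighbourhood is a k-clique [K] together with a set [L] of simplicial
    vertices (its leaves), each leaf being adjacent to all of the (k+1)-clique
    [u |: K] except one vertex of [K]. Frugality makes the exceptional vertices
    of two leaves distinct, and allows a twig with one or two leaves to be
    found in every k-tree with at least k+2 vertices ([exists_small_twig]).

    If a path or cycle of the graph without [L] passes through [u], it enters
    and leaves [u] by two distinct vertices of [K], and since the leaves have
    distinct exceptional vertices they can be inserted next to [u], one on each
    side ([twig_detour]). This alone gives a Hamilton cycle in 2-trees, and a
    Hamilton path between two vertices outside [u |: L].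

    If an end of the wanted Hamilton path lies in [u |: L], then the path is
    routed through [u |: L] first and goes on in the smaller k-tree without [u]
    and [L]; for k at least 3 there is always a free vertex of [K] to enter it
    ([enter_twig], [cross_twig]). The one exception is a path that starts at
    [u] when there are two leaves. There, one takes a path of the graph without
    [L] that starts at a vertex of [K], deletes [u] from its middle, and joins
    the pieces, after reversing the first one if necessary, with the two leaves
    ([splice_root]). This needs a vertex of [K] which is neither exceptional
    for a leaf nor the other end of the path; if there is none, then k = 3 and
    both ends lie in [u |: K], and either there is another twig away from this
    clique, or the graph is so small that the path can be written down
    ([spans_root]). *)

(** * Simplicial vertices of k-trees *)

Lemma disjoint_setU1 (T : finType) (v : T) (B C : {set T}) :
  [disjoint v |: B & C] = (v \notin C) && [disjoint B & C].
Proof. by rewrite -disjointU1; apply: eq_disjoint => z; rewrite !inE. Qed.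

Section Simplicial.
Variables (G : sgraph) (k : nat).
Implicit Types (u v w x y z : G) (A B K L Q X : {set G}).

Definition clique B : Prop := {in B &, forall x y, x != y -> adj x y}.

Definition simplicial A v : Prop := induces_complete k (neighbours v :&: A).

Lemma in_neighbours A v z : (z \in neighbours v :&: A) = adj v z && (z \in A).
Proof. by rewrite !inE. Qed.

Lemma notin_neighbours A v : v \notin neighbours v :&: A.
Proof. by rewrite in_neighbours adj_irrefl. Qed.

Lemma neighbours_remove A v w :
  ~~ adj v w -> neighbours v :&: (A :\ w) = neighbours v :&: A.
Proof.
move=> nvw; apply/setP=> z; rewrite !inE.
by case: eqP => [->|//]; rewrite (negPf nvw).
Qed.

Lemma neighbours_extend A v w : w \in A -> adj v w ->
  neighbours v :&: A = w |: (neighbours v :&: (A :\ w)).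
Proof.
move=> wA vw; apply/setP=> z; rewrite !inE.
by case: eqP => [->|//]; rewrite vw wA.
Qed.

Lemma cliqueU1 B v :
  clique B -> {in B, forall x, adj v x} -> clique (v |: B).
Proof.
move=> cB vB x y; rewrite !inE => /orP[/eqP->|xB] /orP[/eqP->|yB].
- by rewrite eqxx.
- by move=> _; apply: vB.
- by move=> _; rewrite adj_sym; apply: vB.
- exact: cB.
Qed.

Lemma sub_clique A B : A \subset B -> clique B -> clique A.
Proof. by move=> /subsetP sAB cB x y /sAB xB /sAB; apply: cB. Qed.

Lemma simplicial_clique A v :
  simplicial A v -> clique (v |: (neighbours v :&: A)).
Proof.
by case=> _ cN; apply: cliqueU1 => // x; rewrite in_neighbours => /andP[].
Qed.

Lemma simplicial_card A v :
  simplicial A v -> #|v |: (neighbours v :&: A)| = k.+1.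
Proof. by case=> cN _; rewrite cardsU1 notin_neighbours cN. Qed.

Lemma simplicial_remove A v w :
  ~~ adj v w -> simplicial A v -> simplicial (A :\ w) v.
Proof. by move=> nvw; rewrite /simplicial neighbours_remove. Qed.

Lemma simplicial_neighbours A v : simplicial A v -> v \in A ->
  #|A| = k.+1 -> neighbours v :&: A = A :\ v.
Proof.
move=> [cN _] vA cA; apply/eqP; rewrite eqEcard cN.
have -> : #|A :\ v| = k by have := cardsD1 v A; rewrite vA; lia.
rewrite leqnn andbT; apply/subsetP=> z; rewrite !inE => /andP[vz ->].
by rewrite andbT; apply: contraTneq vz => ->; rewrite adj_irrefl.
Qed.

Lemma ktree_card A : ktree_on k A -> k <= #|A|.
Proof.
elim=> {A} [A [-> //] | A v vA [<- _] _ _].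
by apply: subset_leq_card; apply: subsetIr.
Qed.

Lemma ktree_complete_or_large A : ktree_on k A -> clique A \/ k.+1 < #|A|.
Proof.
case=> {}A => [[_ cA]|v vA sv kA]; first by left.
have [le|lt] := leqP #|A| k.+1; [left | by right].
have cA : #|A| = k.+1.
  by apply/eqP; rewrite eqn_leq le (cardsD1 v A) vA ltnS ktree_card.
by have := simplicial_clique sv; rewrite (simplicial_neighbours sv) // setD1K.
Qed.

Lemma ktree_min_degree A x : ktree_on k A -> k < #|A| -> x \in A ->
  k <= #|neighbours x :&: A|.
Proof.
move=> kA; elim: kA x => {A} [A [-> _] x | A v vA sv kA IH x ltkA xA].
  by rewrite ltnn.
have [->|xv] := eqVneq x v; first by case: sv => ->.
have cA : #|A| = #|A :\ v|.+1 by rewrite (cardsD1 v A) vA.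
have xAv : x \in A :\ v by rewrite !inE xv.
have [ltk|lek] := ltnP k #|A :\ v|.
  apply: leq_trans (IH x ltk xAv) _.
  by apply: subset_leq_card; apply: setIS; apply: subsetDl.
have cA' : #|A| = k.+1 by have := ktree_card kA; lia.
have eN := simplicial_neighbours sv vA cA'.
have -> : neighbours x :&: A = A :\ x.
  apply/setP=> z; rewrite !inE.
  case: (eqVneq z x) => [->|zx]; first by rewrite adj_irrefl.
  case zA: (z \in A); rewrite ?andbF ?andbT //=.
  have := simplicial_clique sv; rewrite eN setD1K // => cl.
  by apply: cl; rewrite // eq_sym.
by have := cardsD1 x A; rewrite xA; lia.
Qed.

(** The vertex [v] need not be the last one of the given construction. With more
    than k+1 vertices, it is not adjacent to the last vertex [w], since
    otherwise it would have degree less than [k] in [A :\ w], and so the two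
    deletions commute. With k+1 vertices, the graph is complete. *)
Lemma ktree_remove A v : ktree_on k A -> k < #|A| -> v \in A ->
  simplicial A v -> ktree_on k (A :\ v).
Proof.
move=> kA; elim: kA v => {A} [A [-> _] v | A w wA sw kA IH v ltkA vA sv].
  by rewrite ltnn.
have [->//|vw] := eqVneq v w.
have cA : #|A| = #|A :\ w|.+1 by rewrite (cardsD1 w A) wA.
have vAw : v \in A :\ w by rewrite !inE vw.
have [ltk|lek] := ltnP k #|A :\ w|; last first.
  have cA' : #|A| = k.+1 by have := ktree_card kA; lia.
  by apply: ktree_complete; rewrite -(simplicial_neighbours sv vA cA').
have nvw : ~~ adj v w.
  apply/negP=> a; have := ktree_min_degree kA ltk vAw.
  have := neighbours_extend wA a => eN.
  have [] := sv; rewrite eN cardsU1 !inE eqxx /= andbF /=; lia.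
have nwv : ~~ adj w v by rewrite adj_sym.
apply: (@ktree_extend _ _ _ w); first by rewrite !inE eq_sym vw.
  exact: simplicial_remove.
have -> : A :\ v :\ w = A :\ w :\ v by apply/setP=> z; rewrite !inE andbCA.
by apply: IH => //; apply: simplicial_remove.
Qed.

(** A map that is constant along the edges outside [X] takes at most as many
    values as there are components, and some such map separates them all. So
    the bound says that a k-clique leaves at most two components and a
    (k+1)-clique at most three. Maps are handier here than components, because
    they extend to an additional simplicial vertex at once. *)
Definition frugal A : Prop :=
  forall X (f : G -> G), k <= #|X| <= k.+1 ->
  {in A :\: X &, forall x y, adj x y -> f x = f y} ->
  #|f @: (A :\: X)| + k <= #|X| + 2.

(** The neighbours of a simplicial vertex outside [X] are pairwise adjacent,
    hence carry a common value, which can be given to the vertex. *)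
Lemma frugal_remove A v :
  v \in A -> simplicial A v -> frugal A -> frugal (A :\ v).
Proof.
move=> vA sv frA X f cX fP.
have inD z : (z \in (A :\ v) :\: X) = (z != v) && (z \in A :\: X).
  by rewrite !inE andbCA.
pose N := neighbours v :&: A :\: X.
have inN z : (z \in N) = [&& z \notin X, adj v z & z \in A].
  by rewrite !inE.
(* If no neighbour of [v] is outside [X], then any value will do. *)
pose c := if [pick z in N] is Some z then f z else f v.
pose g z := if z == v then c else f z.
have cN z : z \in N -> c = f z.
  rewrite /c; case: pickP => [y yN zN|/(_ z) -> //].
  have [-> //|yz] := eqVneq y z.
  move: yN zN; rewrite !inN => /and3P[yX vy yA] /and3P[zX vz zA].
  apply: fP; rewrite ?inE ?yX ?zX ?yA ?zA ?andbT /=.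
  - by apply: contraTneq vy => ->; rewrite adj_irrefl.
  - by apply: contraTneq vz => ->; rewrite adj_irrefl.
  - by apply: (proj2 sv); rewrite // in_neighbours ?vy ?vz ?yA ?zA.
have gP : {in A :\: X &, forall x y, adj x y -> g x = g y}.
  move=> x y xA yA; rewrite /g.
  case: (eqVneq x v) => [->|xv]; case: (eqVneq y v) => [->|yv] // a.
  - by apply: cN; move: yA; rewrite inN a !inE.
  - by apply/esym/cN; move: xA; rewrite inN adj_sym a !inE.
  - by apply: fP; rewrite ?inD ?xv ?yv.
apply: leq_trans (frA X g cX gP); rewrite leq_add2r.
apply: subset_leq_card; apply/subsetP=> _ /imsetP[x xA ->].
move: xA; rewrite inD => /andP[xv xA]; apply/imsetP; exists x => //.
by rewrite /g (negPf xv).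
Qed.

(** Vertices with all their neighbours in [X] are components by themselves, and
    [z] accounts for one more when it is not one of them. *)
Lemma frugal_isolated A X (I : {set G}) z : frugal A ->
  k <= #|X| <= k.+1 -> I \subset A :\: X ->
  {in I, forall v, neighbours v :&: A \subset X} ->
  z \in A :\: X ->
  #|z |: I| + k <= #|X| + 2.
Proof.
move=> frA cX sI isoI zA.
pose f v := if v \in I then v else z.
have nI v x : v \in I -> x \in A :\: X -> adj v x = false.
  move=> vI; rewrite inE => /andP[xX xA]; apply/negP=> a.
  by move/subsetP/(_ x): (isoI v vI);
    rewrite in_neighbours a xA (negPf xX) => /(_ isT).
have fP : {in A :\: X &, forall x y, adj x y -> f x = f y}.
  move=> x y xA yA a; rewrite /f; case: ifP => [xI|_].
    by rewrite (nI _ _ xI yA) in a.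
  by case: ifP => // yI; rewrite adj_sym (nI _ _ yI xA) in a.
apply: leq_trans (frA X f cX fP); rewrite leq_add2r.
apply: subset_leq_card; apply/subsetP=> x; rewrite !inE => /orP[/eqP->|xI].
  by apply/imsetP; exists z => //; rewrite /f; case: ifP.
by apply/imsetP; exists x; rewrite /f ?xI //; apply: (subsetP sI).
Qed.

Definition frugal_ktree A : Prop := ktree_on k A /\ frugal A.

Lemma frugal_ktree_remove A v :
  frugal_ktree A -> k < #|A| -> v \in A -> simplicial A v ->
    frugal_ktree (A :\ v).
Proof.
by case=> kA frA ltk vA sv; split; [apply: ktree_remove | apply: frugal_remove].
Qed.

End Simplicial.

(** * Twigs and stars *)

Section Twigs.
Variables (G : sgraph) (k : nat).
Implicit Types (u v w x y z : G) (A B K L Q X : {set G}).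

Record twig A u K L : Prop := Twig {
  twig_in : u \in A;
  twig_neighbours : neighbours u :&: A = K :|: L;
  twig_disjoint : [disjoint K & L];
  twig_complete : induces_complete k K;
  twig_simplicial : {in L, forall v, simplicial k A v};
  twig_sub : {in L, forall v, neighbours v :&: A \subset u |: K} }.

Lemma twig_subset A u K L : twig A u K L -> u |: (K :|: L) \subset A.
Proof.
by move=> tw; rewrite subUset sub1set (twig_in tw) -(twig_neighbours tw)
  subsetIr.
Qed.

(** The shape in which no twig with a leaf is disjoint from [Q]: the neighbours of
    a vertex outside [Q] all lie in [Q]. *)
Definition star A Q : Prop :=
  {in A :\: Q, forall v, simplicial k A v /\ neighbours v :&: A \subset Q}.

Lemma leaf_twig A v w : w \in A -> simplicial k A w -> v \in A -> adj w v ->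
  simplicial k (A :\ w) v ->
  twig A v (neighbours v :&: (A :\ w)) [set w].
Proof.
move=> wA sw vA wv sv; split=> //.
- by rewrite (neighbours_extend wA) 1?adj_sym // setUC.
- by rewrite disjoint_sym disjoints1 !inE eqxx /= andbF.
- by move=> _ /set1P->.
move=> _ /set1P->; apply/subsetP=> z; rewrite in_neighbours => /andP[wz zA].
rewrite !inE zA andbT; case: eqVneq => //= zv.
rewrite (proj2 sw) ?in_neighbours ?wv ?wz 1?eq_sym //=.
by apply: contraTneq wz => ->; rewrite adj_irrefl.
Qed.

Lemma twig_stay A w u K L : w \in A -> simplicial k A w ->
  twig (A :\ w) u K L -> {in u |: L, forall v, ~~ adj w v} -> twig A u K L.
Proof.
move=> wA sw [uA eN dKL cK sL subL] nw.
have nwu : ~~ adj u w by rewrite adj_sym nw // !inE eqxx.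
have nwL v : v \in L -> neighbours v :&: (A :\ w) = neighbours v :&: A.
  by move=> vL; rewrite neighbours_remove // adj_sym nw // !inE vL orbT.
split=> //; first by move: uA; rewrite inE => /andP[].
- by rewrite -eN neighbours_remove.
- by move=> v vL; rewrite /simplicial -nwL //; apply: sL.
- by move=> v vL; rewrite -nwL //; apply: subL.
Qed.

(** Adding a simplicial vertex [w] to a k-tree does not destroy its twigs: if
    [w] is attached to a leaf, then this leaf becomes the root of a new twig;
    if it is attached to the root only, then it is a new leaf; otherwise the
    twig is untouched. *)
Lemma twig_grow A w u K L : w \in A -> simplicial k A w ->
  twig (A :\ w) u K L -> L != set0 ->
  exists u' K' L',
    [/\ twig A u' K' L', L' != set0 & u' |: L' \subset w |: (u |: L)].
Proof.
move=> wA sw tw L0; have [uA eN dKL cK sL subL] := tw.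
have [/existsP[v /andP[vL wv]]|/existsPn nwL] :=
  boolP [exists v, (v \in L) && adj w v].
  exists v, (neighbours v :&: (A :\ w)), [set w]; split.
  - have vA : v \in neighbours u :&: (A :\ w) by rewrite eN inE vL orbT.
    apply: leaf_twig => //; last exact: sL.
    by move: vA; rewrite !inE => /and3P[].
  - by apply/set0Pn; exists w; rewrite inE.
  - by apply/subsetP=> z; rewrite !inE => /orP[/eqP->|/eqP->];
      rewrite ?vL ?eqxx ?orbT.
have nwL' v : v \in L -> ~~ adj w v.
  by move=> vL; apply: contraNN (nwL v) => ->; rewrite vL.
have uA' : u \in A by move: uA; rewrite inE => /andP[].
case wu : (adj w u); last first.
  exists u, K, L; split=> //; last exact: subsetU1.
  apply: (twig_stay wA sw tw) => v; rewrite !inE => /orP[/eqP->|/nwL'] //.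
  by rewrite wu.
have eNA : neighbours u :&: A = w |: (K :|: L).
  by rewrite (neighbours_extend wA) ?eN // adj_sym.
have wKL : w \notin K :|: L by rewrite -eN !inE eqxx /= andbF.
exists u, K, (w |: L); split.
- split=> //.
  + by rewrite eNA setUCA.
  + rewrite disjoint_sym disjoint_setU1 disjoint_sym dKL andbT.
    by apply: contra wKL => wK; rewrite inE wK.
  + move=> v; rewrite !inE => /orP[/eqP->//|vL].
    by rewrite /simplicial -(@neighbours_remove _ _ _ w) 1?adj_sym ?nwL' //;
      apply: sL.
  move=> v; rewrite !inE => /orP[/eqP->|vL]; last first.
    by rewrite -(@neighbours_remove _ _ _ w) 1?adj_sym ?nwL' //; apply: subL.
  apply/subsetP=> z zN; have [zu|zu] := eqVneq z u; first by rewrite zu setU11.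
  have uz : adj u z by apply: (proj2 sw);
    rewrite // ?in_neighbours ?wu // eq_sym.
  have : z \in neighbours u :&: A by move: zN; rewrite !inE uz => /andP[_ ->].
  move: zN; rewrite eNA !inE => /andP[wz _] /or3P[/eqP zw|->|zL];
    rewrite ?orbT //.
    by move: wz; rewrite zw adj_irrefl.
  by rewrite (negPf (nwL' _ zL)) in wz.
- by apply/set0Pn; exists w; rewrite setU11.
by rewrite setUCA.
Qed.

Lemma star_twig A Q u : star A Q -> Q \subset A -> clique Q -> #|Q| = k.+1 ->
  u \in Q -> twig A u (Q :\ u) (neighbours u :&: (A :\: Q)).
Proof.
move=> st sQA clQ cQ uQ; split.
- exact: (subsetP sQA).
- apply/setP=> z; rewrite !inE; case zQ: (z \in Q);
    rewrite ?andbT ?andbF ?orbF /=.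
    rewrite (subsetP sQA) // andbT; case: eqVneq => [->|zu];
      first exact: adj_irrefl.
    by apply: clQ; rewrite // eq_sym.
  done.
- by rewrite -setI_eq0; apply/eqP/setP=> z; rewrite !inE; case: (z \in Q);
    rewrite ?andbF.
- split; first by have := cardsD1 u Q; rewrite uQ; lia.
  exact: sub_clique (subD1set _ _) clQ.
- by move=> v; rewrite in_setI => /andP[_ /st[]].
- by move=> v; rewrite in_setI setD1K // => /andP[_ /st[]].
Qed.

(** Induction along the construction of the k-tree, where [w] is the last
    vertex and [N] its neighbourhood. If [w] is not in [Q], a star for [Q] is
    either enlarged by [w], or [w] is attached to one of its outer vertices,
    which becomes the root of a twig with leaf [w]. If [w] is in [Q], apply the
    induction hypothesis to [N], which contains the rest of [Q]: a twig away
    from [N] is unaffected by [w]; in a star around [z |: N] the outer vertices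
    adjacent to [z] are the leaves of a twig with root [z], and if there are
    none, then the star can be centred at [w |: N] instead. *)
Lemma star_or_twig A Q : ktree_on k A -> k < #|A| -> Q \subset A -> clique Q ->
  exists2 Q' : {set G}, Q \subset Q' &
    [/\ Q' \subset A, clique Q', #|Q'| = k.+1
      & star A Q' \/
        exists u K L,
          [/\ twig A u K L, L != set0 & [disjoint u |: L & Q']]].
Proof.
move=> kA; elim: kA Q => {A} [A [-> _] Q|A w wA sw kA IH Q ltkA sQA clQ].
  by rewrite ltnn.
have cA : #|A| = #|A :\ w|.+1 by rewrite (cardsD1 w A) wA.
set N := neighbours w :&: A.
have sNwA : w |: N \subset A by rewrite subUset sub1set wA subsetIr.
have clNw := simplicial_clique sw.
have cNw := simplicial_card sw.
have [ltk|lek] := ltnP k #|A :\ w|; last first.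
  have cA' : #|A| = k.+1 by have := ktree_card kA; lia.
  have eA : w |: N = A by rewrite /N (simplicial_neighbours sw) // setD1K.
  exists A => //; split=> //; first by rewrite -eA.
  by left=> v; rewrite setDv inE.
have sNA : N \subset A :\ w.
  by rewrite subsetD1 subsetIr /N notin_neighbours.
have [wQ|wQ] := boolP (w \in Q).
  have sQN : Q \subset w |: N.
    apply/subsetP=> z zQ; rewrite !inE (subsetP sQA) // andbT.
    by case: eqVneq => //= zw; apply: clQ; rewrite // eq_sym.
  exists (w |: N) => //; split=> //.
  have clN := proj2 sw.
  have [Q0 sNQ0 [sQ0A clQ0 cQ0]] := IH N ltk sNA clN.
  case=> [st|[u [K [L [tw L0 dis]]]]]; last first.
    right; exists u, K, L.
    have sMA v : v \in u |: L -> v \in A :\ w.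
      move=> vM; apply: (subsetP (twig_subset tw)).
      by move: vM; rewrite !inE => /orP[->//|->]; rewrite !orbT.
    have nM v : v \in u |: L -> v \notin w |: N.
      move=> vM; have := disjointFr dis vM => vQ0.
      rewrite in_setU1 negb_or (contraFN (subsetP sNQ0 v) vQ0) andbT.
      by have := sMA v vM; rewrite !inE => /andP[].
    split=> //; last by rewrite disjoint_subset; apply/subsetP=> v /nM.
    apply: (twig_stay wA sw tw) => v vM; apply: contra (nM v vM) => wv.
    by have := sMA v vM; rewrite !inE wv => /andP[_ ->]; rewrite orbT.
  have [z zQ0 zN] : exists2 z, z \in Q0 & z \notin N.
    apply/subsetPn; apply/negP=> /subset_leq_card.
    by rewrite cQ0 (proj1 sw) ltnn.
  have eQ0 : Q0 = z |: N.
    apply/eqP; rewrite eq_sym eqEcard subUset sub1set zQ0 sNQ0 cQ0 cardsU1 zN.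
    by rewrite (proj1 sw) add1n leqnn.
  have zA : z \in A :\ w by apply: (subsetP sQ0A).
  have [zw zA'] : z != w /\ z \in A by move: zA; rewrite !inE => /andP[].
  have nzw : ~~ adj w z.
    by apply: contra zN => wz; rewrite /N !inE wz.
  have tw0 := star_twig st sQ0A clQ0 cQ0 zQ0.
  have eQ0N : Q0 :\ z = N by rewrite eQ0 setU1K.
  set L := neighbours z :&: (A :\ w :\: Q0) in tw0.
  have LQ0 v : v \in L -> v \in A :\ w :\: Q0 by rewrite inE => /andP[].
  have nwL v : v \in L -> ~~ adj w v.
    move/LQ0; rewrite !inE => /and3P[vQ0 _ vA]; apply: contra vQ0 => wv.
    by apply: (subsetP sNQ0); rewrite /N !inE wv.
  have tw : twig A z N L.
    rewrite -eQ0N; apply: (twig_stay wA sw tw0) => v.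
    by rewrite in_setU1 => /orP[/eqP->|/nwL].
  have [L0|L0] := eqVneq L set0; last first.
    right; exists z, N, L; split=> //.
    rewrite disjoint_subset; apply/subsetP=> v; rewrite in_setU1.
    case/orP=> [/eqP->|/LQ0]; first by rewrite !inE (negPf zw) (negPf nzw).
    rewrite !inE => /and3P[vQ0 vw vA]; rewrite (negPf vw) vA /= andbT.
    by apply: contra vQ0 => wv; apply: (subsetP sNQ0); rewrite /N !inE wv.
  left=> v; rewrite in_setD in_setU1 => /andP[/norP[vw vN] vA].
  have nwv : ~~ adj w v by apply: contra vN => wv; rewrite !inE wv.
  have [->|vz] := eqVneq v z.
    have eNz := twig_neighbours tw; rewrite L0 setU0 in eNz.
    by rewrite /simplicial eNz; split; [exact: sw | apply: subsetUr].
  have vD : v \in A :\ w :\: Q0.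
    by rewrite eQ0 in_setD in_setU1 negb_or vz vN !inE vw.
  have [sv subv] := st v vD.
  rewrite neighbours_remove 1?adj_sym // in subv.
  rewrite /simplicial neighbours_remove 1?adj_sym // in sv.
  split=> //; apply/subsetP=> y yN.
  have := subsetP subv y yN; rewrite eQ0 in_setU1 => /orP[/eqP yz|yN'];
    last first.
    by rewrite in_setU1 yN' orbT.
  have : v \in L.
    by rewrite inE vD inE adj_sym; move: yN; rewrite yz !inE => /andP[->].
  by rewrite L0 inE.
have sQ : Q \subset A :\ w by rewrite subsetD1 sQA wQ.
have [Q0 sQQ0 [sQ0A clQ0 cQ0 H]] := IH Q ltk sQ clQ.
exists Q0 => //; split=> //; first exact: subset_trans sQ0A (subD1set _ _).
have wQ0 : w \notin Q0 by apply/negP=> /(subsetP sQ0A); rewrite !inE eqxx.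
case: H => [st|[u [K [L [tw L0 dis]]]]]; last first.
  have [u' [K' [L' [tw' L0' sub']]]] := twig_grow wA sw tw L0.
  right; exists u', K', L'; split=> //.
  by apply: disjointWl sub' _; rewrite disjoint_setU1 wQ0.
have [sN|] := boolP (N \subset Q0).
  left=> v; rewrite in_setD => /andP[vQ0 vA].
  have [->//|vw] := eqVneq v w.
  have nvw : ~~ adj v w.
    by apply: contra vQ0 => vw'; apply: (subsetP sN); rewrite !inE adj_sym vw'.
  have [] := st v; first by rewrite !inE vQ0 vw.
  by rewrite /simplicial neighbours_remove.
case/subsetPn=> v vN vQ0; right.
have [wv vA] : adj w v /\ v \in A by move: vN; rewrite in_neighbours => /andP[].
have vD : v \in A :\ w :\: Q0.
  by rewrite !inE vQ0 vA andbT; apply: contraTneq wv => ->; rewrite adj_irrefl.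
exists v, (neighbours v :&: (A :\ w)), [set w]; split.
- by apply: leaf_twig => //; case: (st v vD).
- by apply/set0Pn; exists w; rewrite inE.
- by rewrite disjoint_setU1 vQ0 disjoints1.
Qed.

Lemma twig_root_notin A u K L : twig A u K L -> u \notin K :|: L.
Proof. by move=> tw; rewrite -(twig_neighbours tw) notin_neighbours. Qed.

Lemma twig_body_card A u K L : twig A u K L -> #|u |: K| = k.+1.
Proof.
move=> tw; have := twig_root_notin tw; rewrite inE => /norP[uK _].
by rewrite cardsU1 uK (proj1 (twig_complete tw)).
Qed.

Lemma twig_body_clique A u K L : twig A u K L -> clique (u |: K).
Proof.
move=> tw; apply: cliqueU1; first exact: proj2 (twig_complete tw).
move=> x xK; have : x \in neighbours u :&: A
  by rewrite (twig_neighbours tw) inE xK.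
by rewrite in_neighbours => /andP[].
Qed.

Lemma twig_leaf_adj A u K L v : twig A u K L -> v \in L ->
  [/\ v \in A, adj v u & v \notin u |: K].
Proof.
move=> tw vL; have : v \in neighbours u :&: A
  by rewrite (twig_neighbours tw) inE vL orbT.
rewrite in_neighbours => /andP[uv vA]; split=> //; first by rewrite adj_sym.
rewrite in_setU1 negb_or (disjointFl (twig_disjoint tw) vL) andbT.
by apply: contraTneq uv => ->; rewrite adj_irrefl.
Qed.

Lemma twig_body_sub A u K L : twig A u K L -> u |: K \subset A :\: L.
Proof.
move=> tw; apply/subsetP=> z zuK; have /subsetP/(_ z) := twig_subset tw.
rewrite in_setD !inE; have [zL|zL] /= := boolP (z \in L); last first.
  by apply; move: zuK; rewrite !inE => /orP[]->; rewrite ?orbT.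
by case: (twig_leaf_adj tw zL) => _ _; rewrite zuK.
Qed.

Lemma twig_missing A u K L v : twig A u K L -> v \in L ->
  exists2 w, w \in K & neighbours v :&: A = (u |: K) :\ w.
Proof.
move=> tw vL; have [vA vu _] := twig_leaf_adj tw vL.
have uN : u \in neighbours v :&: A by rewrite in_neighbours vu (twig_in tw).
have cN := proj1 (twig_simplicial tw vL).
have sN := twig_sub tw vL.
have [w wuK wN] : exists2 w, w \in u |: K & w \notin neighbours v :&: A.
  apply/subsetPn; apply/negP=> /subset_leq_card.
  by rewrite cN (twig_body_card tw) ltnn.
exists w.
  by move: wuK; rewrite in_setU1 => /orP[/eqP wu|//]; rewrite wu uN in wN.
apply/eqP; rewrite eqEcard subsetD1 sN wN cN.
by have := cardsD1 w (u |: K); rewrite wuK (twig_body_card tw); lia.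
Qed.

Lemma adj_missing A u K L v w c : twig A u K L ->
  neighbours v :&: A = (u |: K) :\ w -> c \in K -> adj v c = (c != w).
Proof.
move=> tw eN cK; have cA : c \in A.
  by apply: (subsetP (twig_subset tw)); rewrite !inE cK orbT.
have /setP/(_ c) := eN; rewrite in_neighbours cA andbT => ->.
by rewrite !inE cK orbT andbT.
Qed.

(** Otherwise the common neighbourhood of [v1] and [v2], a k-clique, would cut
    off [v1], [v2] and some further vertex. *)
Lemma twin_leaves A v1 v2 : frugal k A -> v1 \in A -> v2 \in A -> v1 != v2 ->
  simplicial k A v1 -> neighbours v1 :&: A = neighbours v2 :&: A ->
  A \subset v1 |: (v2 |: (neighbours v1 :&: A)).
Proof.
move=> frA v1A v2A v12 sv eN; apply: contraT => /subsetPn[z zA].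
rewrite !in_setU1 => /norP[z1 /norP[z2 zN]].
have := @frugal_isolated _ _ A (neighbours v1 :&: A) [set v1; v2] z frA.
rewrite (proj1 sv) cardsU1 cards2 v12 in_set2 (negPf z1) (negPf z2) leqnn
  leqnSn.
rewrite in_setD zN zA => H.
suff: 1 + 2 + k <= k + 2 by clear; lia.
apply: H => //.
  apply/subsetP=> x /set2P[]->; first by rewrite in_setD notin_neighbours.
  by rewrite in_setD eN notin_neighbours.
by move=> x /set2P[]->; rewrite -?eN.
Qed.

Lemma missing_neq A u K L v1 v2 w1 w2 : frugal k A -> twig A u K L ->
  v1 \in L -> v2 \in L -> v1 != v2 -> w1 \in K ->
  neighbours v1 :&: A = (u |: K) :\ w1 ->
  neighbours v2 :&: A = (u |: K) :\ w2 -> w1 != w2.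
Proof.
move=> frA tw v1L v2L v12 w1K e1 e2; apply/eqP=> w12; rewrite -w12 in e2.
have [v1A _ n1] := twig_leaf_adj tw v1L;
  have [v2A _ n2] := twig_leaf_adj tw v2L.
have w1uK : w1 \in u |: K by rewrite in_setU1 w1K orbT.
have w1A : w1 \in A by have /subsetP/(_ w1 w1uK) := twig_body_sub tw;
  case/setDP.
have sv1 := twig_simplicial tw v1L.
have /subsetP/(_ w1 w1A) :=
  twin_leaves frA v1A v2A v12 sv1 (etrans e1 (esym e2)).
rewrite e1 !in_setU1 setD11 orbF => /orP[]/eqP e; move: n1 n2.
  by rewrite -e w1uK.
by rewrite -e w1uK.
Qed.

Lemma twig_remove A u K L v : twig A u K L -> v \in L ->
  twig (A :\ v) u K (L :\ v).
Proof.
move=> tw vL; have [vA vu vuK] := twig_leaf_adj tw vL.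
have [uA eN dKL cK sL subL] := tw.
have nv x : x \in L -> ~~ adj x v.
  move=> xL; apply: contra vuK => xv; apply: (subsetP (subL x xL)).
  by rewrite in_neighbours xv.
split=> //.
- rewrite !inE uA andbT; apply: contraNneq vuK => ->; exact: setU11.
- rewrite setIDA eN setDUl; congr (_ :|: _).
  apply/setDidPl; rewrite disjoint_sym disjoints1.
  by apply: contra vuK; rewrite in_setU1 => ->; rewrite orbT.
- by apply: disjointWr dKL; apply: subD1set.
- by move=> x /setD1P[_ xL]; rewrite /simplicial neighbours_remove ?nv //;
    apply: sL.
- by move=> x /setD1P[_ xL]; rewrite neighbours_remove ?nv //; apply: subL.
Qed.

Lemma twig_order A u K L : twig A u K L -> k < #|A|.
Proof.
move=> tw; rewrite -(twig_body_card tw); apply: subset_leq_card.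
exact: subset_trans (twig_body_sub tw) (subsetDl _ _).
Qed.

Lemma twig_prune A u K L : frugal_ktree k A -> twig A u K L ->
  twig (A :\: L) u K set0 /\ frugal_ktree k (A :\: L).
Proof.
have [n] := ubnP #|L|; elim: n A L => // n IH A L; rewrite ltnS => cL gA tw.
have [L0|[v vL]] := set_0Vmem L; first by rewrite L0 setD0 in tw *.
have [vA _ _] := twig_leaf_adj tw vL.
have -> : A :\: L = A :\ v :\: (L :\ v) by rewrite setDDl setD1K.
apply: IH; last exact: twig_remove.
  by move: cL; rewrite (cardsD1 v L) vL.
apply: frugal_ktree_remove => //;
  [exact: twig_order tw | exact: twig_simplicial tw _ vL].
Qed.

Lemma twig_prune_root A u K L : frugal_ktree k A -> twig A u K L ->
  frugal_ktree k (A :\: L :\ u).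
Proof.
move=> gA tw; have [tw0 g0] := twig_prune gA tw.
apply: frugal_ktree_remove => //;
  [exact: twig_order tw0 | exact: twig_in tw0 |].
by rewrite /simplicial (twig_neighbours tw0) setU0; apply: twig_complete tw.
Qed.

(** The (k+1)-clique [u |: K] isolates all leaves, and some vertex of [Q]
    remains besides, because [u] is not in [Q]. *)
Lemma twig_few_leaves A u K L Q : frugal k A -> twig A u K L ->
  Q \subset A -> #|Q| = k.+1 -> [disjoint u |: L & Q] -> #|L| <= 2.
Proof.
move=> frA tw sQ cQ dis.
have uQ : u \notin Q by rewrite (disjointFr dis) // setU11.
have [z zQ zuK] : exists2 z, z \in Q & z \notin u |: K.
  apply/subsetPn; apply: contra uQ => sub.
  have -> : Q = u |: K by apply/eqP;
    rewrite eqEcard sub cQ (twig_body_card tw) leqnn.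
  exact: setU11.
have zL : z \notin L.
  by apply: contraTN zQ => zL; rewrite (disjointFr dis) // in_setU1 zL orbT.
have := @frugal_isolated _ _ A (u |: K) L z frA.
rewrite (twig_body_card tw) leqnSn leqnn cardsU1 zL in_setD zuK (subsetP sQ) //
  => H.
suff: 1 + #|L| + k <= k.+1 + 2 by clear; lia.
apply: H => //; last exact: twig_sub tw.
apply/subsetP=> v vL; have [vA _ vuK] := twig_leaf_adj tw vL.
by rewrite in_setD vuK.
Qed.

(** Only a star with three vertices [S] around [Q] needs care, since a vertex
    of [Q] may be adjacent to all of [S]. The root is then chosen to be the
    vertex [w] of [Q] that [v1] misses; the other two leaves cannot miss it
    too, since they are not twins of [v1]. *)
Lemma exists_small_twig A : 0 < k -> frugal_ktree k A -> k.+1 < #|A| ->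
  exists u K L, [/\ twig A u K L, L != set0 & #|L| <= 2].
Proof.
move=> k0 [kA frA] cA.
have [|Q _ [sQA clQ cQ]] := @star_or_twig A set0 kA (ltnW cA) (sub0set _).
  by move=> x y; rewrite inE.
case=> [st|[u [K [L [tw L0 dis]]]]]; last first.
  exists u, K, L; split=> //; exact: twig_few_leaves tw sQA cQ dis.
set S := A :\: Q in st.
have cS : 0 < #|S| by have := cardsID Q A; rewrite (setIidPr sQA) -/S; lia.
have [v1 v1S] : exists v1, v1 \in S by apply/set0Pn; rewrite -card_gt0.
have {}cS : #|S| <= 3.
  have := @frugal_isolated _ _ A Q S v1 frA.
  have -> : v1 |: S = S by apply/setUidPr; rewrite sub1set.
  rewrite cQ leqnSn leqnn => H.
  suff: #|S| + k <= k.+1 + 2 by lia.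
  by apply: H => // v /st[].
have [sv1 subv1] := st v1 v1S.
have [v1A v1Q] : v1 \in A /\ v1 \notin Q by move: v1S;
  rewrite in_setD => /andP[].
have star_at u : u \in Q -> twig A u (Q :\ u) (neighbours u :&: S).
  exact: star_twig.
have [cS2|cS2] := leqP #|S| 2.
  have [u uN] : exists u, u \in neighbours v1 :&: A.
    by apply/set0Pn; rewrite -card_gt0 (proj1 sv1).
  exists u, (Q :\ u), (neighbours u :&: S); split.
  - exact: star_at (subsetP subv1 u uN).
  - apply/set0Pn; exists v1; rewrite in_setI v1S andbT inE adj_sym.
    by move: uN; rewrite in_neighbours => /andP[].
  - by apply: leq_trans cS2; apply: subset_leq_card; apply: subsetIr.
have [w wQ wN] : exists2 w, w \in Q & w \notin neighbours v1 :&: A.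
  apply/subsetPn; apply/negP=> /subset_leq_card.
  by rewrite cQ (proj1 sv1) ltnn.
have wA := subsetP sQA w wQ.
have eN v : v \in S -> ~~ adj v w -> neighbours v :&: A = Q :\ w.
  move=> /st[[cN _] sub] nvw; apply/eqP; rewrite eqEcard cN subsetD1 sub.
  by rewrite in_neighbours (negPf nvw) /= -ltnS -cQ (cardsD1 w Q) wQ.
have n1w : ~~ adj v1 w by move: wN; rewrite in_neighbours wA andbT.
exists w, (Q :\ w), (neighbours w :&: S); split; first exact: star_at.
- apply/negP=> /eqP noL.
  have [v2] : exists v2, v2 \in S :\ v1.
    apply/set0Pn; rewrite -card_gt0 -(ltn_add2l 1) addn0.
    by move: cS2; rewrite (cardsD1 v1 S) v1S => /ltnW.
  case/setD1P=> v21 v2S.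
  have n2w : ~~ adj v2 w.
    by apply/negP=> a; have := in_set0 v2;
      rewrite -noL in_setI v2S inE adj_sym a.
  have v2A : v2 \in A by move: v2S; rewrite in_setD => /andP[].
  have v2Q : v2 \notin Q by move: v2S; rewrite in_setD => /andP[].
  rewrite eq_sym in v21.
  have := twin_leaves frA v1A v2A v21 sv1 (etrans (eN v1 v1S n1w) (esym (eN v2
    v2S n2w))).
  move/subsetP/(_ w wA); rewrite (eN v1) // !in_setU1 setD11 orbF.
  by case/orP=> /eqP e; [move: v1Q | move: v2Q]; rewrite -e wQ.
- have sub : neighbours w :&: S \subset S :\ v1.
    by rewrite subsetD1 subsetIr !inE adj_sym (negPf n1w).
  by apply: leq_trans (subset_leq_card sub) _; move: cS;
    rewrite (cardsD1 v1 S) v1S.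
Qed.

End Twigs.

(** * From toughness to frugality *)

Section Toughness.
Variable G : sgraph.
Implicit Types (X : {set G}) (f : G -> G).

(** Each value is taken at the root of some component. *)
Lemma components_labels X f :
  {in ~: X &, forall x y, adj x y -> f x = f y} ->
  #|f @: ~: X| <= components_minus X.
Proof.
move=> fP.
have conn x y : connect (adj_minus X) x y -> x \notin X ->
    y \notin X /\ f x = f y.
  move/connectP=> [p + ->];
    elim: p x => //= z p IH x /andP[/and3P[xX zX xz] zp] _.
  have [-> <-] := IH z zp zX; split=> //.
  by apply: fP; rewrite ?in_setC.
have sym : connect_sym (adj_minus X).
  by apply: sym_connect_sym => x y; rewrite /adj_minus /= adj_sym andbCA.
rewrite /components_minus /n_comp_mem.
apply: leq_trans (leq_imset_card f _).
apply: subset_leq_card; apply/subsetP=> _ /imsetP[x xX ->].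
rewrite in_setC in xX.
have [rX fr] := conn _ _ (connect_root _ x) xX.
by rewrite fr; apply: imset_f; rewrite !inE /= roots_root.
Qed.

Lemma toughness_separating X : separating X ->
  (toughness G <= (#|X|%:R / (components_minus X)%:R)%R%:E)%E.
Proof. by move=> sX; rewrite /toughness; apply: bigmin_le_cond. Qed.

Lemma tough_components X (a b : nat) : 0 < b -> separating X ->
  ((a%:R / b%:R)%R%:E <= toughness G)%E -> a * components_minus X <= b * #|X|.
Proof.
move=> b0 sX ta; have := le_trans ta (toughness_separating sX).
have c0 : 0 < components_minus X by apply: ltnW.
rewrite lee_fin ler_pdivrMr ?ltr0n // mulrAC ler_pdivlMr ?ltr0n //.
by rewrite -!natrM ler_nat [#|X| * _]mulnC.
Qed.

Lemma toughness_gt_components X (a b : nat) : 0 < b -> separating X ->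
  ((a%:R / b%:R)%R%:E < toughness G)%E -> a * components_minus X < b * #|X|.
Proof.
move=> b0 sX ta; have := lt_le_trans ta (toughness_separating sX).
have c0 : 0 < components_minus X by apply: ltnW.
rewrite lte_fin ltr_pdivrMr ?ltr0n // mulrAC ltr_pdivlMr ?ltr0n //.
by rewrite -!natrM ltr_nat [#|X| * _]mulnC.
Qed.

Lemma frugal_components k :
  (forall X, k <= #|X| <= k.+1 -> separating X ->
     components_minus X + k <= #|X| + 2) ->
  frugal k [set: G].
Proof.
move=> H X f cX; rewrite setTD => /components_labels le.
have [c2|c2] := leqP (components_minus X) 1; first by lia.
by have := H X cX c2; lia.
Qed.

Lemma tough_frugal k : 2 < k ->
  ((k%:R / 3%:R)%R%:E < toughness G)%E -> frugal k [set: G].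
Proof.
move=> k2 tk; apply: frugal_components => X cX sX.
by have := toughness_gt_components (isT : 0 < 3) sX tk; nia.
Qed.

Lemma one_tough_frugal : tough G 1%R -> frugal 2 [set: G].
Proof.
move=> t1; apply: frugal_components => X cX sX.
have := @tough_components X 1 1 isT sX; rewrite divr1 => /(_ t1); lia.
Qed.

End Toughness.

(** * Hamilton paths of induced subgraphs *)

Section Spans.
Variable G : sgraph.
Implicit Types (a b u v x y z : G) (A B : {set G}) (p q s : seq G).

(** Hamilton paths of the subgraph induced by [A]. A list that covers [A] and
    is no longer than [#|A|] has no repetition and no element outside [A]
    ([tight_cover]); this form reduces surgery on paths to checking a covering
    and a length. *)
Definition spans A x y : Prop :=
  exists p, [/\ path (@adj G) x p, last x p = y, {subset A <= x :: p}
              & size p < #|A|].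

Lemma tight_cover A s :
  {subset A <= s} -> size s <= #|A| -> uniq s /\ s =i A.
Proof.
move=> sub sz; have sub' : {subset enum A <= s} by move=> z;
  rewrite mem_enum => /sub.
rewrite cardE in sz; have uA := enum_uniq (mem A).
have [_ eq] := uniq_min_size uA sub' sz.
split; first exact: leq_size_uniq uA sub' sz.
by move=> z; rewrite -eq mem_enum.
Qed.

Lemma reverse_walk x p : path (@adj G) x p ->
  exists q, [/\ path (@adj G) (last x p) q, last (last x p) q = x,
    last x p :: q =i x :: p & size q = size p].
Proof.
move=> xp; exists (rev (belast x p)); split.
- rewrite rev_path; apply: sub_path xp => y z /=; by rewrite adj_sym.
- by case: p xp => //= y p _; rewrite rev_cons last_rcons.
- by move=> z; rewrite -rev_rcons -lastI mem_rev.
- by rewrite size_rev size_belast.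
Qed.

Lemma spans_sym A x y : spans A x y -> spans A y x.
Proof.
case=> p [xp <- sub sz]; have [q [yq lq eq sq]] := reverse_walk xp.
by exists q; split=> //; [move=> z /sub; rewrite eq | rewrite sq].
Qed.

Lemma spans1 x : spans [set x] x x.
Proof. by exists [::]; split; rewrite ?cards1 // => z /set1P->;
  rewrite inE. Qed.

Lemma spans_cat A B x y x' y' : spans A x y -> spans B x' y' -> adj y x' ->
  [disjoint A & B] -> spans (A :|: B) x y'.
Proof.
case=> p [xp lp subp sp] [q [xq lq subq sq]] yx dis.
exists (p ++ x' :: q); split.
- by rewrite cat_path xp lp /= yx.
- by rewrite last_cat.
- move=> z; rewrite inE -cat_cons mem_cat => /orP[/subp->//|/subq->].
  by rewrite orbT.
- by rewrite size_cat /= cardsU disjoint_setI0 // cards0; lia.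
Qed.

Lemma spans2 x y : adj x y -> spans [set x; y] x y.
Proof.
move=> xy; apply: (spans_cat (spans1 x) (spans1 y) xy).
by rewrite disjoints1 inE; apply: contraTneq xy => ->; rewrite adj_irrefl.
Qed.

Lemma clique_path A x p : clique A -> uniq (x :: p) -> {subset x :: p <= A} ->
  path (@adj G) x p.
Proof.
move=> cA; elim: p x => //= y p IH x /andP[xyp uyp] sub.
rewrite IH // ?andbT; last by move=> z zp; apply: sub; rewrite inE zp orbT.
apply: cA; rewrite ?sub ?inE ?eqxx ?orbT //.
by apply: contraNneq xyp => ->; rewrite inE eqxx.
Qed.

Lemma clique_spans A x y : clique A -> x \in A -> y \in A -> x != y ->
  spans A x y.
Proof.
move=> cA xA yA xy; exists (rcons (enum (A :\ x :\ y)) y).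
have sz : size (rcons (enum (A :\ x :\ y)) y) < #|A|.
  rewrite size_rcons -cardE (cardsD1 x A) xA (cardsD1 y (A :\ x)).
  by rewrite !inE yA eq_sym xy.
have sub : {subset A <= x :: rcons (enum (A :\ x :\ y)) y}.
  move=> z zA; rewrite inE mem_rcons inE mem_enum !inE zA andbT.
  by case: eqP => //=; case: eqP.
split=> //; last by rewrite last_rcons.
have [un eq] := tight_cover sub sz.
by apply: clique_path cA un _ => z; rewrite eq.
Qed.

Lemma spans_split A u x y : spans A x y -> u \in A -> u != x -> u != y ->
  exists a b p q,
    [/\ path (@adj G) x p /\ last x p = a, path (@adj G) b q /\ last b q = y,
        [/\ a \in A, b \in A & a != b], adj a u /\ adj u b
      & {subset A <= x :: p ++ u :: b :: q} /\ size p + size q + 2 < #|A|].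
Proof.
case=> r [xr lr sub sz] uA ux uy.
have [un eq] := tight_cover sub sz.
have : u \in r by have := sub u uA; rewrite inE (negPf ux).
move=> ur; case/splitPr: r / ur xr lr sub sz un eq => p [|b q].
  by rewrite /= cat_path last_cat /= => _ uy'; rewrite uy' eqxx in uy.
rewrite cat_path last_cat /= => /and4P[xp lu ub bq] lq sub sz un eq.
exists (last x p), b, p, q; split=> //.
- split.
  + by rewrite -eq -cat_cons mem_cat mem_last.
  + by rewrite -eq -cat_cons mem_cat !inE eqxx !orbT.
  + move: (un : uniq ((x :: p) ++ [:: u, b & q]));
      rewrite cat_uniq => /and3P[_ /hasPn H _].
    have := H b; rewrite !inE eqxx orbT => /(_ isT).
    by apply: contraNneq => <-; have := mem_last x p; rewrite inE.
- by split=> //; move: sz; rewrite size_cat /=; lia.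
Qed.

End Spans.

(** * Hamilton-connected k-trees *)

Section HamiltonConnected.
Variables (G : sgraph) (k : nat).
Implicit Types (a b c m u v w x y z : G) (A B K L M Q : {set G}).

Lemma root_adj A u K L c : twig k A u K L -> c \in K :|: L -> adj u c.
Proof.
by move=> tw; rewrite -(twig_neighbours tw) in_neighbours => /andP[].
Qed.

(** A leaf fits between [u] and a vertex of [K] unless it misses that vertex.
    Of the two ways to place two leaves on the two sides of [u], one works,
    because [a] and [b] are distinct and so are the vertices missed by the
    leaves. *)
Lemma twig_detour A u K L a b : frugal k A -> twig k A u K L -> #|L| <= 2 ->
  a \in K -> b \in K -> a != b ->
  exists s t, [/\ path (@adj G) a (s ++ u :: rcons t b),
                  {subset L <= s ++ t} & size s + size t <= #|L|].
Proof.
move=> frA tw cL aK bK ab.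
have ua : adj a u by rewrite adj_sym (root_adj tw) // inE aK.
have ub : adj u b by rewrite (root_adj tw) // inE bK.
have vu v : v \in L -> adj v u by case/(twig_leaf_adj tw).
have uv v : v \in L -> adj u v by rewrite adj_sym; apply: vu.
move: cL; rewrite leq_eqVlt => /orP[/cards2P[v1 [v2 [v12 eL]]]|].
  have v1L : v1 \in L by rewrite eL set21.
  have v2L : v2 \in L by rewrite eL set22.
  have [w1 w1K e1] := twig_missing tw v1L.
  have [w2 w2K e2] := twig_missing tw v2L.
  have w12 := missing_neq frA tw v1L v2L v12 w1K e1 e2.
  have adj1 c := adj_missing tw e1 (c := c);
    have adj2 c := adj_missing tw e2 (c := c).
  have [H|H] := boolP ((a != w1) && (b != w2)).
    case/andP: H => aw bw; exists [:: v1], [:: v2]; split.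
    - by rewrite /= adj_sym adj1 // aw vu // uv // adj2 // bw.
    - by move=> z; rewrite eL !inE.
    - by rewrite eL cards2 v12.
  exists [:: v2], [:: v1]; split.
  - rewrite /= adj_sym adj2 // vu // uv // adj1 // !andbT /=.
    move: H; rewrite negb_and !negbK => /orP[/eqP eaw|/eqP ebw].
      by rewrite eaw w12 /= -eaw eq_sym.
    by rewrite -ebw ab /= ebw eq_sym.
  - by move=> z; rewrite eL !inE orbC.
  - by rewrite eL cards2 v12.
rewrite ltnS leq_eqVlt => /orP[/cards1P[v eL]|].
  have vL : v \in L by rewrite eL set11.
  have [w wK e] := twig_missing tw vL.
  have adjv c := adj_missing tw e (c := c).
  have [aw|aw] := eqVneq a w.
    exists [::], [:: v]; split.
    - by rewrite /= ua uv // adjv // -aw eq_sym ab.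
    - by move=> z; rewrite eL !inE.
    - by rewrite eL cards1.
  exists [:: v], [::]; split.
  - by rewrite /= adj_sym adjv // aw vu // ub.
  - by move=> z; rewrite eL !inE.
  - by rewrite eL cards1.
rewrite ltnS leqn0 cards_eq0 => /eqP eL.
exists [::], [::]; split; first by rewrite /= ua ub.
- by move=> z; rewrite eL inE.
- by rewrite eL cards0.
Qed.

Lemma card_prune A u K L : twig k A u K L -> #|A| = #|A :\: L| + #|L|.
Proof.
move=> tw; have sLA : L \subset A.
  by apply/subsetP=> v /(twig_leaf_adj tw)[].
by have := cardsID L A; rewrite (setIidPr sLA); lia.
Qed.

Lemma spans_insert A u K L x y : frugal_ktree k A -> twig k A u K L ->
  #|L| <= 2 ->
  u != x -> u != y -> spans (A :\: L) x y -> spans A x y.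
Proof.
move=> gA tw cL ux uy sp; have [tw0 _] := twig_prune gA tw.
have uA : u \in A :\: L := twig_in tw0.
have [a [b [p [q [[xp lp] [bq lq] [aA bA ab] [au ub] [sub sz]]]]]] :=
  spans_split sp uA ux uy.
have eK := twig_neighbours tw0; rewrite setU0 in eK.
have aK : a \in K by rewrite -eK in_neighbours adj_sym au.
have bK : b \in K by rewrite -eK in_neighbours ub.
have [s [t [ast subL szL]]] := twig_detour (proj2 gA) tw cL aK bK ab.
exists (p ++ s ++ u :: t ++ b :: q); split.
- move: ast; rewrite -cats1 !(cat_path, last_cat) /= !cat_path /= xp lp bq.
  by rewrite !andbT.
- by rewrite !last_cat /= last_cat.
- move=> z zA; have [/subL|zL] := boolP (z \in L).
    by rewrite !(mem_cat, inE) => /orP[]->; rewrite ?orbT.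
  have /sub : z \in A :\: L by rewrite inE zL.
  by rewrite !(mem_cat, inE) => /orP[|/orP[|/orP[|/orP[]]]] ->; rewrite ?orbT.
- rewrite (card_prune tw) !size_cat /= size_cat /=.
  by move: sz szL; clear; lia.
Qed.

Definition hamilton_connected_on A : Prop :=
  {in A &, forall x y, x != y -> spans A x y}.

Hypothesis k_gt2 : 2 < k.

(** A leaf misses one vertex of [K], so with [c0] excluded there is still a
    choice when [k] is at least 3. *)
Lemma twig_reach A u K L m c0 : twig k A u K L -> m \in u |: L ->
  exists c, [/\ c \in K, adj m c & c != c0].
Proof.
move=> tw; have cK := proj1 (twig_complete tw).
have pick w : exists c, [/\ c \in K, c != w & c != c0].
  have [c /setD1P[cc0 /setD1P[cw cK']]] : exists c, c \in K :\ w :\ c0.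
    apply/set0Pn; rewrite -card_gt0.
    have := cardsD1 w K; have := cardsD1 c0 (K :\ w).
    by move: k_gt2 cK; clear; lia.
  by exists c.
rewrite in_setU1 => /orP[/eqP->|mL].
  have [c [cK' _ cc]] := pick u; exists c; split=> //.
  by rewrite (root_adj tw) // inE cK'.
have [w wK e] := twig_missing tw mL; have [c [cK' cw cc]] := pick w.
by exists c; split; rewrite // (adj_missing tw e).
Qed.

Lemma twig_core A u K L : twig k A u K L ->
  [/\ K \subset A :\: L :\ u, A = (u |: L) :|: (A :\: L :\ u)
    & [disjoint u |: L & A :\: L :\ u]].
Proof.
move=> tw; have uK := twig_root_notin tw; split.
- rewrite subsetD1; move: uK; rewrite inE => /norP[-> _]; rewrite andbT.
  exact: subset_trans (subsetUr _ _) (twig_body_sub tw).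
- apply/setP=> z; rewrite !inE; have [->|zu] := eqVneq z u.
    by rewrite (twig_in tw).
  by have [/(twig_leaf_adj tw)[-> _ _]|zL] := boolP (z \in L).
- by rewrite disjoint_subset; apply/subsetP=> z; rewrite !inE;
    case: eqP => //= _ ->.
Qed.

Lemma enter_twig A u K L x m y : twig k A u K L ->
  hamilton_connected_on (A :\: L :\ u) ->
  spans (u |: L) x m -> m \in u |: L -> y \in A :\: L :\ u -> spans A x y.
Proof.
move=> tw hc sp mM yA; have [sK eA dis] := twig_core tw.
have [c [cK mc cy]] := twig_reach y tw mM; rewrite eA.
apply: spans_cat sp _ mc dis; apply: hc => //; exact: (subsetP sK).
Qed.

Lemma cross_twig A u K L M N x m n y : twig k A u K L ->
  hamilton_connected_on (A :\: L :\ u) -> spans M x m -> spans N n y ->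
    m \in u |: L ->
  n \in u |: L -> u |: L = M :|: N -> [disjoint M & N] -> spans A x y.
Proof.
move=> tw hc spM spN mM nM eM dMN; have [sK eA dis] := twig_core tw.
have [c [cK mc _]] := twig_reach u tw mM.
have [d [dK nd dc]] := twig_reach c tw nM.
rewrite eA eM -setUA [N :|: _]setUC setUA.
have dM : [disjoint M & A :\: L :\ u] by apply: disjointWl dis;
  rewrite eM subsetUl.
have dN : [disjoint N & A :\: L :\ u] by apply: disjointWl dis;
  rewrite eM subsetUr.
apply: (@spans_cat _ _ _ _ d n) spN _ _; last first.
- rewrite -setI_eq0 setIUl setU_eq0 !setI_eq0 dMN /=.
  by rewrite disjoint_sym.
- by rewrite adj_sym.
apply: spans_cat spM _ mc dM; apply: hc; rewrite ?(subsetP sK) //.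
by rewrite eq_sym.
Qed.

Lemma leaf_tour A u K v1 v2 : twig k A u K [set v1; v2] -> v1 != v2 ->
  spans (u |: [set v1; v2]) v1 v2.
Proof.
move=> tw v12; have [_ v1u n1] := twig_leaf_adj tw (set21 v1 v2).
have [_ v2u n2] := twig_leaf_adj tw (set22 v1 v2).
rewrite setUA [u |: _]setUC; apply: spans_cat (spans2 v1u) (spans1 v2) _ _.
  by rewrite adj_sym.
rewrite disjoint_sym disjoints1 !inE negb_or eq_sym v12.
by apply: contraNneq n2 => ->; apply: setU11.
Qed.

(** Let the path from [c] to [y] be [c..a,u,b..y]. The vertex [c] is missed by
    neither leaf. With [v] after [u] and [v'] before [b], the walks
    [u,v,c..a,v',b..y] and [u,v,a..c,v',b..y] cover everything, and one of them
    is a path unless [v'] misses [b]. In that case [v] does not miss [b], and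
    the leaves exchange their roles. *)
Lemma splice_root A u K v1 v2 w1 w2 c y : frugal_ktree k A ->
  twig k A u K [set v1; v2] -> v1 != v2 ->
  neighbours v1 :&: A = (u |: K) :\ w1 ->
  neighbours v2 :&: A = (u |: K) :\ w2 -> w1 != w2 ->
  c \in K -> c != w1 -> c != w2 -> u != y ->
  spans (A :\: [set v1; v2]) c y -> spans A u y.
Proof.
move=> gA tw v12 e1 e2 w12 cK cw1 cw2 uy sp.
have [tw0 _] := twig_prune gA tw.
have cu : u != c.
  by apply: contraNneq (twig_root_notin tw) => ->; rewrite inE cK.
have [a [b [p [q [[cp lp] [bq lq] [aA bA ab] [au ub] [sub sz]]]]]] :=
  spans_split sp (twig_in tw0) cu uy.
have eK := twig_neighbours tw0; rewrite setU0 in eK.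
have aK : a \in K by rewrite -eK in_neighbours adj_sym au.
have bK : b \in K by rewrite -eK in_neighbours ub.
have via v v' w w' : [set v1; v2] = [set v; v'] -> w != w' ->
    neighbours v :&: A = (u |: K) :\ w ->
    neighbours v' :&: A = (u |: K) :\ w' ->
    c != w -> c != w' -> b != w' -> spans A u y.
  move=> eL ww' e e' cw cw' bw'.
  have adjv d := adj_missing tw e (c := d).
  have adjv' d := adj_missing tw e' (c := d).
  have [s [r [sr eqr szr vs rv']]] : exists s r,
      [/\ path (@adj G) s r, s :: r =i c :: p, size r = size p, adj v s
        & adj (last s r) v'].
    have [aw'|aw'] := eqVneq a w'; last first.
      by exists c, p; rewrite adjv // cw lp adj_sym adjv'.
    (* [v'] misses [a], hence not [c], and [v] does not miss [a]. *)
    have [r [ar lr eqr szr]] := reverse_walk cp; rewrite lp in ar lr eqr.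
    exists a, r; split=> //; first by rewrite adjv // aw' eq_sym.
    by rewrite lr adj_sym adjv'.
  have vL : v \in [set v1; v2] by rewrite eL set21.
  exists (v :: s :: r ++ v' :: b :: q); split.
  - by rewrite /= cat_path /= (root_adj tw) 1?inE ?vL ?orbT // vs sr rv' adjv'
      // bw' bq.
  - by rewrite /= last_cat.
  - move=> z zA; have [|zL] := boolP (z \in [set v1; v2]).
      by rewrite eL !(mem_cat, inE) => /orP[]->; rewrite ?orbT.
    have /sub : z \in A :\: [set v1; v2] by rewrite inE zL.
    have := eqr z; rewrite !(mem_cat, inE) orbA => <-.
    by rewrite -!orbA => /or4P[|||/orP[]] ->; rewrite ?orbT.
  - by rewrite (card_prune tw) cards2 v12 /= size_cat /= szr; move: sz; clear;
      lia.
have [bw2|bw2] := eqVneq b w2; last exact: (via v1 v2 w1 w2).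
apply: (via v2 v1 w2 w1) => //; first exact: setUC.
  by rewrite eq_sym.
by rewrite bw2 eq_sym.
Qed.

(** A vertex of [K] other than [w1], [w2] and [y] serves as [c] in
    [splice_root]. If there is none, then [k = 3] and [K] consists of these
    three vertices. In this case either the whole graph has a twig disjoint
    from [u |: K], hence free of the ends of the path, or it is a star around
    [u |: K], which has at most one vertex [v3] besides [v1] and [v2]. *)
Lemma spans_root A u K v1 v2 y : frugal_ktree k A ->
  twig k A u K [set v1; v2] -> v1 != v2 ->
  (forall B, #|B| < #|A| -> frugal_ktree k B -> hamilton_connected_on B) ->
  y \in A -> y \notin u |: [set v1; v2] -> spans A u y.
Proof.
move=> gA tw v12 IH yA; rewrite in_setU1 => /norP[yu yL].
have v1L : v1 \in [set v1; v2] := set21 v1 v2.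
have v2L : v2 \in [set v1; v2] := set22 v1 v2.
have [w1 w1K e1] := twig_missing tw v1L.
have [w2 w2K e2] := twig_missing tw v2L.
have w12 := missing_neq (proj2 gA) tw v1L v2L v12 w1K e1 e2.
have cA := card_prune tw; rewrite cards2 v12 /= in cA.
have [_ g0] := twig_prune gA tw.
have uK := twig_root_notin tw; rewrite inE negb_or in uK; case/andP: uK => uK _.
have cK := proj1 (twig_complete tw).
have sQ := twig_body_sub tw.
have [K0|[c]] := set_0Vmem (K :\ w1 :\ w2 :\ y); last first.
  case/setD1P=> cy /setD1P[cw2 /setD1P[cw1 cK']].
  apply: (splice_root gA tw v12 e1 e2 w12 cK' cw1 cw2); first by rewrite eq_sym.
  apply: IH => //; [by move: cA; clear; lia | | by rewrite in_setD yL].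
  by apply: (subsetP sQ); rewrite in_setU1 cK' orbT.
have w2K1 : w2 \in K :\ w1 by rewrite !inE eq_sym w12.
have [k3 yK1] : k = 3 /\ y \in K :\ w1 :\ w2.
  have := cardsD1 w1 K; have := cardsD1 w2 (K :\ w1).
  have := cardsD1 y (K :\ w1 :\ w2); rewrite K0 cards0 w1K w2K1 cK.
  by move: k_gt2; clear; case: (y \in _) => /= *; split=> //; lia.
have [yw2 yw1 yK] : [/\ y != w2, y != w1 & y \in K].
  by move: yK1; rewrite !inE => /and3P[].
have clK := proj2 (twig_complete tw).
have inK z : z \in K -> [|| z == w1, z == w2 | z == y].
  move=> zK; apply: contraT => /norP[z1 /norP[z2 z3]].
  by have := in_set0 z; rewrite -K0 !inE z1 z2 z3 zK.
have adj1 c := adj_missing tw e1 (c := c).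
have adj2 c := adj_missing tw e2 (c := c).
have cQ := twig_body_card tw.
have sQA : u |: K \subset A := subset_trans sQ (subsetDl _ _).
have [Q' sQQ' [_ _ cQ' H]] :=
  star_or_twig (proj1 gA) (twig_order tw) sQA (twig_body_clique tw).
have {sQQ' cQ'} eQ : Q' = u |: K.
  by apply/eqP; rewrite eq_sym eqEcard sQQ' cQ' cQ leqnn.
rewrite {Q'}eQ in H; case: H => [st|[u' [K' [L' [tw' L0' dis]]]]]; last first.
  have nQ z : z \in u |: K -> z \notin u' |: L' by move/(disjointFl dis) ->.
  have := nQ u (setU11 u K); rewrite in_setU1 => /norP[uu' uL'].
  have : y \notin u' |: L' by rewrite nQ // in_setU1 yK orbT.
  rewrite in_setU1 => /norP[yu' yL'].
  have cL' := twig_few_leaves (proj2 gA) tw' sQA cQ dis.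
  apply: (spans_insert gA tw' cL'); rewrite 1?eq_sym //.
  have [_ g'] := twig_prune gA tw'.
  apply: IH => //; rewrite ?in_setD ?uL' ?yL' ?(twig_in tw) // 1?eq_sym //.
  by rewrite (card_prune tw') -[X in X < _]addn0 ltn_add2l card_gt0.
have uv1 : adj u v1 by rewrite (root_adj tw) // inE v1L orbT.
have w1v2 : adj w1 v2 by rewrite adj_sym adj2.
have v1w2 : adj v1 w2 by rewrite adj1 // eq_sym.
have v2y : adj v2 y by rewrite adj2.
(* The path below has six vertices, plus possibly [v3]. *)
have cR : #|A| = #|A :\: [set v1; v2] :\: (u |: K)| + 6.
  have := cardsID (u |: K) (A :\: [set v1; v2]); rewrite (setIidPr sQ) cQ k3.
  by move: cA; clear; lia.
have inA z : z \in A -> [|| z \in u |: K, z == v1, z == v2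
                         | z \in A :\: [set v1; v2] :\: (u |: K)].
  by move=> zA; rewrite !inE zA andbT; case: eqP => //;
    case: (z \in K) => //=; case: eqP => //=; case: eqP.
have [R0|[v3 v3R]] := set_0Vmem (A :\: [set v1; v2] :\: (u |: K)).
  exists [:: v1; w2; w1; v2; y]; split=> //.
  - by rewrite /= uv1 v1w2 w1v2 v2y clK // eq_sym.
  - move=> z /inA; rewrite R0 in_set0 in_setU1 !inE => /or4P[|->|->|//];
      rewrite ?orbT //.
    by case/orP=> [->//|/inK/or3P[]->]; rewrite ?orbT.
  - by rewrite cR R0 cards0.
have nv v : v \in A :\: [set v1; v2] :\: (u |: K) ->
    [/\ v \in A, simplicial k A v & neighbours v :&: A = K].
  rewrite !in_setD => /and3P[vQ vL vA].
  have [|sv sub] := st v; first by rewrite in_setD vQ.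
  split=> //; apply/eqP; rewrite eqEcard (proj1 sv) cK leqnn andbT.
  apply/subsetP=> z zN; have := subsetP sub z zN;
    rewrite in_setU1 => /orP[/eqP zu|//].
  have : v \in neighbours u :&: A.
    by move: zN; rewrite !in_neighbours zu adj_sym vA => /andP[->].
  rewrite (twig_neighbours tw) inE (negPf vL) orbF => vK.
  by rewrite in_setU1 vK orbT in vQ.
have [v3A sv3 eN3] := nv v3 v3R.
have R3 : A :\: [set v1; v2] :\: (u |: K) = [set v3].
  apply/eqP; rewrite eqEsubset sub1set v3R andbT.
  apply/subsetP=> v4 v4R; rewrite inE; apply: contraT; rewrite eq_sym => v34.
  have [v4A _ eN4] := nv v4 v4R.
  have := twin_leaves (proj2 gA) v3A v4A v34 sv3 (etrans eN3 (esym eN4)).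
  move/subsetP/(_ u (twig_in tw)); rewrite eN3 !in_setU1 (negPf uK) orbF.
  by case/orP=> /eqP e; [move: v3R | move: v4R]; rewrite -e in_setD setU11.
have v3K z : z \in K -> adj v3 z by rewrite -eN3 in_neighbours => /andP[].
exists [:: v1; w2; v3; w1; v2; y]; split=> //.
- by rewrite /= uv1 v1w2 w1v2 v2y (v3K _ w1K) adj_sym v3K.
- move=> z /inA; rewrite R3 in_set1 in_setU1 !inE => /or4P[|->|->|->];
    rewrite ?orbT //.
  by case/orP=> [->//|/inK/or3P[]->]; rewrite ?orbT.
- by rewrite cR R3 cards1.
Qed.

(** The cases are the positions of the ends relative to [u |: L]: both outside
    it (insertion of the leaves), exactly one inside ([enter]), both inside
    ([across]). *)
Lemma frugal_ktree_hamilton_connected A : frugal_ktree k A ->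
  hamilton_connected_on A.
Proof.
have [n] := ubnP #|A|; elim: n A => // n IHn A; rewrite ltnS => leA gA.
have [clA|ltA] := ktree_complete_or_large (proj1 gA).
  by move=> x y xA yA; apply: clique_spans.
have [|u [K [L [tw L0 cL]]]] := exists_small_twig _ gA ltA; first by lia.
have IH B : #|B| < #|A| -> frugal_ktree k B -> hamilton_connected_on B.
  by move=> lt; apply: IHn; apply: leq_trans lt leA.
have ltL : #|A :\: L| < #|A|.
  by rewrite (card_prune tw) -[X in X < _]addn0 ltn_add2l card_gt0.
have hcore : hamilton_connected_on (A :\: L :\ u).
  apply: IH; last exact: twig_prune_root tw.
  by apply: leq_ltn_trans ltL; apply: subset_leq_card; apply: subD1set.
have [_ eA _] := twig_core tw.
have uv v : v \in L -> adj u v by case/(twig_leaf_adj tw); rewrite adj_sym.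
have uL : u \notin L by have := twig_root_notin tw; rewrite inE => /norP[].
have out z : z \in A -> z \notin u |: L -> z \in A :\: L :\ u.
  by move=> zA; rewrite in_setU1 => /norP[zu zL]; rewrite !inE zu zL.
have L12 : (exists v, L = [set v]) \/
    exists v1 v2, v1 != v2 /\ L = [set v1; v2].
  move: cL; rewrite leq_eqVlt => /orP[/cards2P[v1 [v2 [v12 ->]]]|].
    by right; exists v1, v2.
  by rewrite ltnS leq_eqVlt ltnNge card_gt0 L0 orbF => /cards1P[v ->]; left;
    exists v.
have inM z : z \in L -> z \in u |: L by move=> zL; rewrite in_setU1 zL orbT.
have uM : u \in u |: L := setU11 u L.
have enter x y : y \in A -> x \in u |: L -> y \notin u |: L -> spans A x y.
  move=> yA xM yM; have yC := out y yA yM.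
  case: L12 => [[v eL]|[v1 [v2 [v12 eL]]]].
    have vL : v \in L by rewrite eL set11.
    move: xM; rewrite in_setU1 {1}eL in_set1 => /orP[]/eqP->.
      apply: (enter_twig tw hcore _ (inM v vL) yC).
      by rewrite eL; apply: spans2; apply: uv.
    apply: (enter_twig tw hcore _ uM yC).
    by rewrite eL setUC; apply: spans2; rewrite adj_sym; apply: uv.
  have tw2 := tw; rewrite eL in tw2.
  move: xM; rewrite in_setU1 {1}eL in_set2 => /or3P[]/eqP->.
  - by apply: (spans_root gA tw2) => //; rewrite -eL.
  - apply: (enter_twig tw hcore _ (inM v2 _) yC); last by rewrite eL set22.
    by rewrite eL; apply: leaf_tour tw2 v12.
  apply: (enter_twig tw hcore _ (inM v1 _) yC); last by rewrite eL set21.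
  by rewrite eL; apply: spans_sym; apply: leaf_tour tw2 v12.
have across x y : x \in L -> y \in u |: L -> x != y -> spans A x y.
  move=> xL; rewrite in_setU1 => yM xy.
  have single z w : z \in L -> w \notin L -> [disjoint [set z] & [set w]].
    by move=> zL; rewrite disjoints1 inE; apply: contraNneq => <-.
  case: L12 => [[v eL]|[v1 [v2 [v12 eL]]]].
    have xv : x = v by move: xL; rewrite eL => /set1P.
    have yu : y = u.
      by move: yM xy; rewrite eL xv inE => /orP[/eqP->//|/eqP->]; rewrite eqxx.
    rewrite yu; apply: (cross_twig tw hcore (spans1 x) (spans1 u) (inM x xL)
      uM).
      by rewrite eL xv setUC.
    exact: single.
  have [v [vL vx eL']] : exists v, [/\ v \in L, v != x & L = [set x; v]].
    move: xL; rewrite eL => /set2P[]->; first by exists v2;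
      rewrite set22 eq_sym.
    by exists v1; rewrite set21 setUC.
  have dis z w : z \in L -> w \in L -> z != w ->
      [disjoint [set z] & [set w; u]] /\ [disjoint [set z; u] & [set w]].
    move=> zL wL zw; have zu : z != u by apply: contraNneq uL => <-.
    have wu : w != u by apply: contraNneq uL => <-.
    rewrite disjoints1 disjoint_sym disjoints1 !inE !negb_or zw zu wu eq_sym zw.
    by [].
  case/orP: yM => [/eqP->|].
    have xv : x != v by rewrite eq_sym.
    have [d _] := dis x v xL vL xv; have vu : adj v u by rewrite adj_sym uv.
    apply: (cross_twig tw hcore (spans1 x) (spans2 vu) (inM x xL) (inM v vL) _
      d).
    by rewrite eL' setUC setUA.
  rewrite {1}eL' in_set2 eq_sym (negPf xy) /= => /eqP yv.
  have yL : y \in L by rewrite yv.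
  have [_ d] := dis x y xL yL xy; have xu : adj x u by rewrite adj_sym uv.
  apply: (cross_twig tw hcore (spans2 xu) (spans1 y) uM (inM y yL) _ d).
  by rewrite eL' yv setUCA setUA.
move=> x y xA yA xy.
have [xM|xM] := boolP (x \in u |: L); have [yM|yM] := boolP (y \in u |: L).
- move: (xM); rewrite in_setU1 => /orP[/eqP xu|xL]; last exact: across.
  apply: spans_sym; apply: across => //; last by rewrite eq_sym.
  by move: yM; rewrite in_setU1 -xu eq_sym (negPf xy).
- exact: enter.
- by apply: spans_sym; apply: enter.
move: xM yM; rewrite !in_setU1 => /norP[xu xL] /norP[yu yL].
apply: (spans_insert gA tw cL); rewrite 1?eq_sym //.
apply: IH => //; first exact: proj2 (twig_prune gA tw).
- by rewrite in_setD xL.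
- by rewrite in_setD yL.
Qed.

End HamiltonConnected.

(** * Hamilton cycles of 2-trees *)

(** A cycle of the graph without the leaves of a twig passes through its root,
    and it has no ends to take care of, so the leaves can always be inserted.
    *)
Lemma frugal_two_tree_cycle (G : sgraph) (A : {set G}) : frugal_ktree 2 A ->
  2 < #|A| ->
  exists c, [/\ cycle (@adj G) c, {subset A <= c} & size c <= #|A|].
Proof.
have [n] := ubnP #|A|; elim: n A => // n IH A; rewrite ltnS => leA gA cA.
have [clA|ltA] := ktree_complete_or_large (proj1 gA).
  have [x [y [xA yA xy]]] := card_gt1P (ltnW cA).
  have [p [xp lp sub sz]] := clique_spans clA xA yA xy.
  by exists (x :: p); split; rewrite //= rcons_path xp lp clA // eq_sym.
have [u [K [L [tw L0 cL]]]] := exists_small_twig (isT : 0 < 2) gA ltA.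
have [tw0 g0] := twig_prune gA tw.
have cAL := card_prune tw; have cA0 := twig_order tw0.
have [|c [cyc sub sz]] := IH (A :\: L) _ g0 cA0.
  by apply: leq_trans leA; rewrite cAL -[X in X < _]addn0 ltn_add2l card_gt0.
have [un eq] := tight_cover sub sz.
have uc : u \in c by rewrite eq (twig_in tw0).
have [i s eR] := rot_to uc.
have {cyc} cyc : cycle (@adj G) (u :: s) by rewrite -eR rot_cycle.
have {un} un : uniq (u :: s) by rewrite -eR rot_uniq.
have {eq} eq : u :: s =i A :\: L by move=> z; rewrite -eR mem_rot eq.
have szs : 1 < size s.
  by move: cA0; rewrite -(eq_card eq) (card_uniqP un).
have {sz} sz : (size s).+1 <= #|A :\: L| by rewrite -(size_rot i) eR in sz.
case: s cyc un eq szs sz {eR} => //= b s.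
rewrite rcons_path => /andP[ub /andP[bs au]] /and3P[_ bns _] eq szs sz.
have eK := twig_neighbours tw0; rewrite setU0 in eK.
have mem_s z : z \in b :: s -> z \in A :\: L by move=> zs;
  rewrite -eq inE zs orbT.
have bK : b \in K by rewrite -eK in_neighbours ub mem_s ?mem_head.
have aK : last b s \in K
  by rewrite -eK in_neighbours adj_sym au mem_s ?mem_last.
have ab : last b s != b.
  apply: contraNneq bns => {1}<-;
    case: s szs {bs au eq sz mem_s aK} => //= z s _.
  exact: mem_last.
have [p [q [apq subL szL]]] := twig_detour (proj2 gA) tw cL aK bK ab.
exists (b :: s ++ p ++ u :: q); split.
- by rewrite /= !rcons_cat rcons_cons cat_path bs.
- move=> z zA; have [/subL|zL] := boolP (z \in L).
    by rewrite !(mem_cat, inE) => /orP[]->; rewrite ?orbT.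
  have : z \in [:: u, b & s] by rewrite eq inE zL.
  by rewrite !(mem_cat, inE) => /or3P[]->; rewrite ?orbT.
- by rewrite cAL /= !size_cat /=; move: sz szL; clear; lia.
Qed.

Theorem theorem5 :
  (forall (k : nat) (G : sgraph),
     3 <= k -> ktree G k -> ((k%:R / 3%:R)%R%:E < toughness G)%E ->
     hamilton_connected G) /\
  (forall G : sgraph,
     ktree G 2 -> tough G 1%R -> ~ is_complete G 2 -> hamiltonian G).
Proof.
split=> [k G k3 kG tG x y xy | G kG tG nG].
  have gG : frugal_ktree k [set: G] by split; last exact: tough_frugal.
  have [p [xp lp sub sz]] :=
    frugal_ktree_hamilton_connected k3 gG (in_setT x) (in_setT y) xy.
  have [un eq] := tight_cover sub sz.
  by exists p; split=> // z; rewrite eq inE.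
have gG : frugal_ktree 2 [set: G] by split; last exact: one_tough_frugal.
have cG : 2 < #|[set: G]|.
  rewrite ltn_neqAle (ktree_card kG) andbT; apply/eqP=> c2; apply: nG.
  have [clG|] := ktree_complete_or_large kG; last by rewrite -c2.
  by split.
have [c [cyc sub sz]] := frugal_two_tree_cycle gG cG.
have [un eq] := tight_cover sub sz.
exists c; split; last by move=> z; rewrite eq inE.
- by apply: leq_trans cG _; rewrite -(eq_card eq) card_size.
- by rewrite /ucycle cyc.
Qed.
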